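(* Consider the $K$-user cooperative NOMA downlink in which the power coefficients of the channel-ordered users satisfy $p_1^2\le p_2^2\le\dots\le p_K^2$ and $\sum_{m=1}^K p_m^2=1$ (the user with the strongest channel gets the most power). Then all users achieve full diversity: for every $k\in\{1,\dots,K\}$ the diversity order of user $k$, computed from the asymptotic ($\rho\to\infty$) upper bound $F^{\infty}_{\gamma_k}$ on the outage probability (CDF) $F_{\gamma_k}(x)=\Pr(\gamma_k\le x)$, is $$\mathcal D_k=-\lim_{\rho\to\infty}\frac{\log F^{\infty}_{\gamma_k}(x)}{\log\rho}=K .$$ Here, for the weakest user, $$F_{\gamma_1}(x)\le F^{\infty}_{\gamma_1}(x)=\frac{xK}{\rho p_1^2}\prod_{j=2}^{K}\frac{x}{\rho q_{j,1}^2},$$ and, for the remaining users $k=K-n$ with $0\le n<K-1$, $$F_{\gamma_{k}}(x)\le F^{\infty}_{\gamma_{k}}(x)=\binom{K}{n}\left(\frac{\omega_{k}(x)}{\rho}\right)^{K-n}\left(\frac1\rho\right)^{n}\prod_{j=k+1}^{K}\omega_{j,k}(x),$$ where $\omega_k(x)=\dfrac{x}{p_k^2-x\sum_{m=1}^{k-1}p_m^2}$ and $\omega_{j,k}(x)=\dfrac{x}{q_{j,k}^2-x\sum_{m=1}^{k-1}q_{j,m}^2}$.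
   Context: Channel model: $|h_1|^2\le|h_2|^2\le\dots\le|h_K|^2$ are the order statistics of $K$ i.i.d. exponential random variables of mean $1$ (base-station-to-user channel power gains, Rayleigh fading). For $1\le k<j\le K$, $|g_{j,k}|^2$ is the channel power gain from user $j$ to user $k$; these are i.i.d. exponential random variables of mean $1$, independent of the $|h_k|^2$. The noise has unit variance and $\rho$ is the transmit power. In the direct phase the base station sends the superposition of all users' messages with coefficients $p_m$. In the cooperative phase, users $j=K,K-1,\dots,2$ successively retransmit, each with power $\rho$, the superposed messages of users $1,\dots,j-1$ with power allocation coefficients $q_{j,m}$, where $\sum_{m=1}^{K-1}q_{K,m}^2=1$. Signal-to-interference-plus-noise ratios after maximum ratio combining of all received copies: for $2\le k\le K$, $$\gamma_k=\frac{|h_k|^2p_k^2}{|h_k|^2\sum_{m=1}^{k-1}p_m^2+\frac1\rho}+\sum_{j=k+1}^{K}\frac{|g_{j,k}|^2q_{j,k}^2}{|g_{j,k}|^2\sum_{m=1}^{k-1}q_{j,m}^2+\frac1\rho}$$ (the second sum is empty for $k=K$), and $$\gamma_1=\rho|h_1|^2p_1^2+\rho\sum_{j=2}^{K}|g_{j,1}|^2q_{j,1}^2 .$$ User $k$ is in outage when $\gamma_k$ does not exceed its threshold $x=\phi_k=2^{R_k}-1$, where $R_k$ is its desired rate. The bounds come from $\Pr(\sum_i A_i\le x)\le\Pr(\bigcap_i\{A_i\le x\})$ for nonnegative random variables, applied to the summands of $\gamma_k$, followed by the approximation $1-e^{-t}\approx t$ as $\rho\to\infty$. For $k\ge2$,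 the CDF of each summand equals $1$ when $x$ exceeds $p_k^2/\sum_{m<k}p_m^2$ (respectively $q_{j,k}^2/\sum_{m<k}q_{j,m}^2$); the expression for $F^\infty_{\gamma_k}$ is obtained by inserting the other, nontrivial branch of these CDFs.
   Formalization: The bound and diversity order are stated for thresholds x>0 in the nontrivial branch: all denominators p_k²−xΣp_m² and q_{j,k}²−xΣq_{j,m}² (m<k) are positive (for k=1: p_1 and q_{j,1} nonzero); otherwise the formula is undefined or the bound fails for large ρ. *)

(* Defs.v *)
From HB Require Import structures.
From mathcomp Require Import all_boot all_order all_algebra.
From mathcomp Require Import all_classical all_reals all_analysis.

Set Implicit Arguments.
Unset Strict Implicit.
Unset Printing Implicit Defensive.

Import Order.TTheory GRing.Theory Num.Theory.
Import numFieldNormedType.Exports.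

Local Open Scope classical_set_scope.
Local Open Scope ring_scope.

(* Users are numbered 1, ..., K as in the usual presentation: families indexed
   by nat are only ever constrained and evaluated on that range.  All h's and
   g's below are the squared moduli |h|^2, |g|^2 (power gains). *)

Section Independence.
Context d (T : measurableType d) (R : realType) (P : probability T R).

Definition mutually_independent (I : choiceType) (D : set I)
    (X : I -> {RV P >-> R}) : Prop :=
  forall (s : seq I) (B : I -> set R),
    uniq s -> (forall i, i \in s -> D i) -> (forall i, measurable (B i)) ->
    P (\bigcap_(i in [set` s]) (X i @^-1` B i)) =
      (\prod_(i <- s) P (X i @^-1` B i))%E.

Definition sigma_generated (I : Type) (D : set I) (X : I -> T -> R) :
    set (set T) :=
  <<s \bigcup_(i in D) preimage_set_system setT (X i) measurable >>.

Definition independent_families (I J : Type) (D : set I) (E : set J)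
    (X : I -> T -> R) (Y : J -> T -> R) : Prop :=
  forall A B, sigma_generated D X A -> sigma_generated E Y B ->
    P (A `&` B) = (P A * P B)%E.

(* The mean is the inverse of the rate, so mean 1 is rate 1.  The two measures
   are compared on measurable sets only, where they are meaningful. *)
Definition exponential_mean1 (X : {RV P >-> R}) : Prop :=
  forall A : set R, measurable A -> distribution P X A = exponential_prob 1 A.

End Independence.

Section Channel.
Context d (T : measurableType d) (R : realType) (P : probability T R).

(* k-th smallest, 1 <= k <= K, of H 1, ..., H K *)
Definition order_statistic (K : nat) (H : nat -> T -> R) (k : nat) (w : T) : R :=
  nth 0 (sort <=%R [seq H i w | i <- iota 1 K]) k.-1.

Definition users (K : nat) : set nat := [set k | (1 <= k <= K)%N].

(* the pairs (j, k) with 1 <= k < j <= K *)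
Definition user_links (K : nat) : set (nat * nat) :=
  [set jk | (1 <= jk.2 < jk.1)%N /\ (jk.1 <= K)%N].

(* H: base-station-to-user gains before ordering;
   g j k: gain from user j to user k. *)
Record rayleigh_channel (K : nat) (H : nat -> {RV P >-> R})
    (g : nat -> nat -> {RV P >-> R}) : Prop := RayleighChannel {
  direct_indep : mutually_independent (users K) H;
  direct_exp : forall k, users K k -> exponential_mean1 (H k);
  coop_indep :
    mutually_independent (user_links K) (fun jk => g jk.1 jk.2);
  coop_exp : forall jk, user_links K jk -> exponential_mean1 (g jk.1 jk.2);
  coop_direct_indep :
    independent_families P (user_links K) (users K)
      (fun jk => g jk.1 jk.2 : T -> R) (order_statistic K H) }.

(* SINR of user k after maximum ratio combining; h k w is the k-th ordered
   gain. *)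
Definition sinr (K : nat) (p : nat -> R) (q : nat -> nat -> R)
    (h : nat -> T -> R) (g : nat -> nat -> T -> R)
    (rho : R) (k : nat) (w : T) : R :=
  if k == 1%N then
    rho * h 1%N w * p 1%N ^+ 2 +
    rho * \sum_(2 <= j < K.+1) g j 1%N w * q j 1%N ^+ 2
  else
    (h k w * p k ^+ 2) / (h k w * (\sum_(1 <= m < k) p m ^+ 2) + 1 / rho) +
    \sum_(k.+1 <= j < K.+1)
      (g j k w * q j k ^+ 2) /
      (g j k w * (\sum_(1 <= m < k) q j m ^+ 2) + 1 / rho).

Definition outage (K : nat) (p : nat -> R) (q : nat -> nat -> R)
    (H : nat -> {RV P >-> R}) (g : nat -> nat -> {RV P >-> R})
    (rho : R) (k : nat) (x : R) : \bar R :=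
  P [set w | sinr K p q (order_statistic K H) g rho k w <= x].

End Channel.

Section Bound.
Context (R : realType).

Definition omega (p : nat -> R) (k : nat) (x : R) : R :=
  x / (p k ^+ 2 - x * \sum_(1 <= m < k) p m ^+ 2).

Definition outage_bound (K : nat) (p : nat -> R) (q : nat -> nat -> R)
    (k : nat) (x rho : R) : R :=
  if k == 1%N then
    (x * K%:R) / (rho * p 1%N ^+ 2) *
    \prod_(2 <= j < K.+1) (x / (rho * q j 1%N ^+ 2))
  else
    let n := (K - k)%N in
    'C(K, n)%:R * (omega p k x / rho) ^+ (K - n) * (1 / rho) ^+ n *
    \prod_(k.+1 <= j < K.+1) omega (q j) k x.

(* x < p_k^2 / sum_(m < k) p_m^2 and x < q_(j,k)^2 / sum_(m < k) q_(j,m)^2,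
   cleared of denominators so that a zero denominator means no upper limit on
   x.  For k = 1 the sums are empty and this says that p_1 and all q_(j,1) are
   nonzero, i.e. that the bound for user 1 is well defined. *)
Definition nontrivial_branch (K : nat) (p : nat -> R) (q : nat -> nat -> R)
    (k : nat) (x : R) : Prop :=
  x * (\sum_(1 <= m < k) p m ^+ 2) < p k ^+ 2 /\
  (forall j, (k < j <= K)%N ->
     x * (\sum_(1 <= m < k) q j m ^+ 2) < q j k ^+ 2).

Definition has_diversity_order (F : R -> R) (D : R) : Prop :=
  ln (F rho) / ln rho @[rho --> +oo] --> - D.

End Bound.

(* Main.v *)
(** On the event that all gains are nonnegative, which has probability one,
    [gamma_k <= x] bounds each summand of [gamma_k] by [x], and each of these
    conditions is a linear upper bound on a single gain: [h_k <= omega_k / rho]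
    and [g_(j,k) <= omega_(j,k) / rho].  By independence the outage probability
    is at most the product of the probabilities of these events.  An exponential
    gain is at most [t] with probability [1 - exp (- t) <= t], and the [k]-th
    order statistic is at most [t] iff some [k] of the [K] gains are, so the
    union bound gives ['C(K, k) t ^ k].  The resulting bound is a positive
    constant times [rho ^- K], whence the diversity order [K].  User 1 is not a
    special case: for [k = 1] the interference sums are empty. *)

Require Import Defs.
From HB Require Import structures.
From mathcomp Require Import all_boot all_order all_algebra.
From mathcomp Require Import all_classical all_reals all_analysis.
From mathcomp Require Import measurable_realfun ring lra.

Set Implicit Arguments.
Unset Strict Implicit.
Unset Printing Implicit Defensive.

Import Order.TTheory GRing.Theory Num.Theory.
Import numFieldNormedType.Exports.
Local Open Scope classical_set_scope.
Local Open Scope ring_scope.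

(** * Union bounds and lower tails of exponential gains *)

Section Probability.
Context d (T : measurableType d) (R : realType) (P : probability T R).

Lemma probability_bigsetU_le (I : Type) (s : seq I) (F : I -> set T) :
  (forall i, measurable (F i)) ->
  (P (\big[setU/set0]_(i <- s) F i) <= \sum_(i <- s) P (F i))%E.
Proof.
move=> mF; elim: s => [|i s IHs]; first by rewrite !big_nil measure0.
rewrite !big_cons; apply: (le_trans (measureU2 _ _ _)) => //.
  exact: bigsetU_measurable.
exact: leeD2l.
Qed.

Lemma measurable_rv_le (X : {RV P >-> R}) t : measurable [set w | X w <= t].
Proof.
rewrite (_ : [set w | _] = X @^-1` `]-oo, t]); last first.
  by apply/seteqP; split=> w /=; rewrite in_itv.
exact: measurable_funPTI.
Qed.

Lemma measurable_rv_lt (X : {RV P >-> R}) t : measurable [set w | X w < t].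
Proof.
rewrite (_ : [set w | _] = X @^-1` `]-oo, t[); last first.
  by apply/seteqP; split=> w /=; rewrite in_itv.
exact: measurable_funPTI.
Qed.

Lemma exponential_mean1_lt0 (X : {RV P >-> R}) :
  exponential_mean1 X -> P [set w | X w < 0] = 0%E.
Proof.
move=> expX; rewrite (_ : [set w | _] = X @^-1` `]-oo, 0[); last first.
  by apply/seteqP; split=> w /=; rewrite in_itv.
have -> : P (X @^-1` `]-oo, 0[) = exponential_prob 1 `]-oo, 0[ by exact: expX.
apply: integral0_eq => x /=; rewrite in_itv/= => x0.
by rewrite lt0_exponential_pdf.
Qed.

(** The negative half-line carries no mass and [[0, t]] has mass [1 - expR (- t)], which convexity
    of the exponential bounds by [t]. *)
Lemma exponential_mean1_le (X : {RV P >-> R}) t :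
  exponential_mean1 X -> 0 < t -> (P [set w | (X w <= t)%R] <= t%:E)%E.
Proof.
move=> expX t0; have X0t : P (X @^-1` `[0, t]) = (1 - expR (- t))%:E.
  by rewrite [LHS](expX `[0, t]%classic)// exponential_prob_itv0c// mulN1r.
have mX0t : measurable (X @^-1` `[0, t]) by exact: measurable_funPTI.
apply: (@le_trans _ _ (P ([set w | X w < 0] `|` X @^-1` `[0, t]))).
  apply: le_measure; rewrite ?inE //; first exact: measurable_rv_le.
    by apply: measurableU => //; exact: measurable_rv_lt.
  by move=> w /= Xt; case: (ltP (X w) 0) => X0; [left|right; rewrite in_itv/= X0].
apply: (le_trans (measureU2 _ _ _)) => //; first exact: measurable_rv_lt.
rewrite [X in (X + _)%E]exponential_mean1_lt0// add0e [leLHS]X0t.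
rewrite lee_fin lerBlDr -lerBlDl.
by rewrite (le_trans _ (expR_ge1Dx _)).
Qed.

(** Independence factors the probability, and each factor is an exponential lower tail. The index
    type is left general so that this serves both users and pairs of users. *)
Lemma mutually_independent_exponential_le (I : choiceType) (D : set I)
    (X : I -> {RV P >-> R}) (s : seq I) (t : I -> R) :
  mutually_independent D X -> (forall i, D i -> exponential_mean1 (X i)) ->
  uniq s -> (forall i, i \in s -> D i) -> (forall i, i \in s -> 0 < t i) ->
  (P (\bigcap_(i in [set` s]) [set w | (X i w <= t i)%R]) <=
   (\prod_(i <- s) t i)%:E)%E.
Proof.
move=> indepX expX us sD t0.
rewrite (_ : \bigcap_(i in _) _ =
    \bigcap_(i in [set` s]) (X i @^-1` `]-oo, t i])); last first.
  by apply: eq_bigcapr => i _; apply/seteqP; split=> w /=; rewrite in_itv.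
rewrite [leLHS](indepX s (fun i => `]-oo, t i]%classic))//.
rewrite big_seq [in leRHS]big_seq.
(* the induction also carries nonnegativity, for [lee_pmul] *)
apply: (@proj2 ((0 <= \prod_(i <- s | i \in s) P (X i @^-1` `]-oo, t i]))%E)).
elim/big_rec2: _ => [|i y z si [z0 zy]]; first by rewrite lexx.
split; first by rewrite mule_ge0.
rewrite EFinM lee_pmul//.
rewrite (_ : _ @^-1` _ = [set w | X i w <= t i]); last first.
  by apply/seteqP; split=> w /=; rewrite in_itv.
by apply: exponential_mean1_le; [exact/expX/sD|exact: t0].
Qed.

End Probability.

(** * Order statistics as counts of small values *)

Section OrderStatistics.
Context d (T : measurableType d) (R : realType).

(** In a sorted list the values at most [t] form a prefix, and sorting does not change their number.
    The shift [i.+1] matches ordinals from 0 with users from 1. *)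
Lemma order_statistic_le (K : nat) (H : nat -> T -> R) (k : nat) (w : T) (t : R) :
  (1 <= k <= K)%N ->
  (order_statistic K H k w <= t) =
  (k <= #|[set i : 'I_K | (H i.+1 w <= t)%R]%SET|)%N.
Proof.
move=> /andP[k0 kK]; rewrite /order_statistic.
have -> : #|[set i : 'I_K | (H i.+1 w <= t)%R]%SET| =
    count (<= t) (sort <=%R [seq H i w | i <- iota 1 K]).
  rewrite (permP (permEl (perm_sort _ _))) count_map cardsE cardE /enum_mem.
  rewrite size_filter -enumT /= (iotaDl 1 0) -(val_enum_ord K) -map_comp.
  by rewrite !count_map; exact: eq_count.
have : size (sort <=%R [seq H i w | i <- iota 1 K]) = K.
  by rewrite size_sort size_map size_iota.
have : sorted <=%O (sort <=%R [seq H i w | i <- iota 1 K]).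
  exact: sort_le_sorted.
move: (sort _ _) => s ss sz.
case: (leqP k (count (<= t) s)) => kt.
  by rewrite nth_count_le // prednK.
apply/negbTE; rewrite -ltNge nth_count_gt //.
by rewrite sz -(leq_add2r 1) !addn1 !prednK // kt.
Qed.

(** Only index sets of size exactly [k] are used, so that a union bound over them has ['C(K, k)]
    terms with [k] gains each. *)
Lemma order_statistic_le_setE (K : nat) (H : nat -> T -> R) (k : nat) (t : R) :
  (1 <= k <= K)%N ->
  [set w | order_statistic K H k w <= t] =
  \big[setU/set0]_(A <- enum [set A : {set 'I_K} | #|A| == k]%SET)
    \bigcap_(i in [set` [seq (val j).+1 | j <- enum A]]) [set w | H i w <= t].
Proof.
move=> kK; rewrite -bigcup_seq; apply/seteqP; split => w /=.
  rewrite order_statistic_le//.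
  set S := [set i | _]%SET => kS.
  (* [S] may have more than [k] elements; the first [k] of its enumeration form the witness. *)
  have uk : uniq (take k (enum S)) by rewrite take_uniq// enum_uniq.
  have sk : size (take k (enum S)) = k by rewrite size_takel// -cardE.
  exists [set i in take k (enum S)]%SET => /=.
    by rewrite mem_enum inE cardsE (card_uniqP uk) sk.
  move=> i /= /mapP[j]; rewrite mem_enum inE => /mem_take.
  by rewrite mem_enum inE => ? ->.
move=> [A /=]; rewrite mem_enum inE => /eqP kA HA.
rewrite order_statistic_le// -kA subset_leq_card//.
apply/fintype.subsetP => i iA; rewrite inE; apply: HA => /=.
by apply/mapP; exists i => //; rewrite mem_enum.
Qed.

End OrderStatistics.

(** * Measurability and lower tail of the ordered gains *)

Section RayleighOrderStatistics.
Context d (T : measurableType d) (R : realType) (P : probability T R).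
Variables (K : nat) (H : nat -> {RV P >-> R}).

Lemma measurable_order_statistic (k : nat) :
  (1 <= k <= K)%N -> measurable_fun setT (order_statistic K H k).
Proof.
(* It suffices to test the rays []t, +oo[], whose preimages are complements of sublevel sets. *)
move=> kK mT; apply: (measurability _ (RGenOInfty.measurableE R)) => //.
move=> _ [_ [t ->] <-]; rewrite setTI.
rewrite (_ : _ @^-1` _ = ~` [set w | order_statistic K H k w <= t]).
  apply: measurableC; rewrite order_statistic_le_setE//.
  apply: bigsetU_measurable => A _; apply: fin_bigcap_measurable => // i _.
  exact: measurable_rv_le.
apply/seteqP; split => w /=; rewrite in_itv/= andbT ltNge; first exact/negP.
by move/negP.
Qed.

Lemma order_statistic_exponential_le (k : nat) (t : R) :
  mutually_independent (users K) H ->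
  (forall i, users K i -> exponential_mean1 (H i)) ->
  (1 <= k <= K)%N -> 0 < t ->
  (P [set w | (order_statistic K H k w <= t)%R] <= ('C(K, k)%:R * t ^+ k)%:E)%E.
Proof.
move=> indepH expH kK t0; rewrite order_statistic_le_setE//.
apply: (le_trans (probability_bigsetU_le _ _ _)).
  move=> A; apply: fin_bigcap_measurable => // i _; exact: measurable_rv_le.
(* The bound is spread into a sum of [t ^+ k] over all [k]-subsets, to be compared term by term with
   the union bound. *)
rewrite -[K in 'C(K, k)]card_ord -card_draws mulr_natl -sumr_const.
rewrite big_enum/= -sumEFin; apply: lee_sum => A; rewrite inE => /eqP kA.
have usersA i : i \in [seq (val j).+1 | j <- enum A] -> users K i.
  by move=> /mapP[j _ ->] /=; exact: ltn_ord.
have us : uniq [seq (val j).+1 | j <- enum A].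
  by rewrite map_inj_uniq ?enum_uniq// => i j [] /val_inj.
apply: (le_trans (mutually_independent_exponential_le indepH expH us usersA _)) => //.
by rewrite big_map big_enum prodr_const kA.
Qed.

End RayleighOrderStatistics.

(** * Algebra and decay rate of the asymptotic bound *)

Section Bound.
Context (R : realType).

Lemma omega_gt0 (p : nat -> R) (k : nat) (x : R) :
  0 < x -> x * (\sum_(1 <= m < k) p m ^+ 2) < p k ^+ 2 -> 0 < omega p k x.
Proof. by move=> x0 xp; rewrite divr_gt0// subr_gt0. Qed.

(** Clearing the positive denominator makes the condition linear in [h]; on the nontrivial branch
    the coefficient of [h] is positive, so it can be divided out. *)
Lemma le_omega (p : nat -> R) (k : nat) (x rho h : R) :
  0 < rho -> 0 <= h -> x * (\sum_(1 <= m < k) p m ^+ 2) < p k ^+ 2 ->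
  (h * p k ^+ 2) / (h * (\sum_(1 <= m < k) p m ^+ 2) + 1 / rho) <= x ->
  h <= omega p k x / rho.
Proof.
rewrite /omega; have : 0 <= \sum_(1 <= m < k) p m ^+ 2.
  by apply: sumr_ge0 => m _; exact: sqr_ge0.
move: (\sum_(1 <= m < k) _) (p k ^+ 2) => S a S0 rho0 h0 xSa.
have den0 : 0 < h * S + 1 / rho.
  by rewrite ltr_wpDl ?mulr_ge0// divr_gt0.
rewrite ler_pdivrMr// => hx.
rewrite ler_pdivlMr// ler_pdivlMr ?subr_gt0//.
have := ler_wpM2r (ltW rho0) hx.
have -> : x * (h * S + 1 / rho) * rho = x * h * S * rho + x.
  by field; rewrite gt_eqF.
by move=> ?; lra.
Qed.

(** The quotient of logarithms equals [ln C / ln rho - n%:R], and its first term vanishes in the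
    limit. *)
Lemma has_diversity_order_power (F : R -> R) (C : R) (n : nat) :
  0 < C -> (forall rho, 0 < rho -> F rho = C * rho^-1 ^+ n) ->
  has_diversity_order F n%:R.
Proof.
move=> C0 FE; apply/cvgrPdist_lt => e e0.
near=> rho.
have rho0 : 0 < rho by near: rho; apply: nbhs_pinfty_gt; exact: num_real.
(* This threshold makes the error [ln C / ln rho] smaller than [e] and also forces [ln rho] to be
   positive. *)
have lnrho : `|ln C| / e < ln rho by rewrite -ltr_expR lnK ?posrE.
have lnrho0 : 0 < ln rho by rewrite (le_lt_trans _ lnrho)// divr_ge0// ltW.
rewrite FE// lnM ?posrE ?exprn_gt0 ?invr_gt0// lnXn ?invr_gt0// lnV ?posrE//.
rewrite mulrDl mulNrn mulNr -[ln rho *+ n]mulr_natl mulfK ?gt_eqF//.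
rewrite opprD addrCA opprK addNr addr0.
rewrite normrN normrM normfV (gtr0_norm lnrho0) ltr_pdivrMr//.
by move: lnrho; rewrite ltr_pdivrMr// mulrC.
Unshelve. all: by end_near.
Qed.

Lemma prod_natMr (m n : nat) (F : nat -> R) (c : R) :
  \prod_(m <= j < n) (F j * c) = (\prod_(m <= j < n) F j) * c ^+ (n - m).
Proof. by rewrite big_split/= prodr_const_nat. Qed.

(** One form for all users, with one factor per independent event: empty interference sums absorb
    the case [k = 1], and the symmetry of binomials replaces [K - k] by [k]. *)
Lemma outage_boundE (K : nat) (p : nat -> R) (q : nat -> nat -> R)
    (k : nat) (x rho : R) : (1 <= k <= K)%N ->
  outage_bound K p q k x rho =
  'C(K, k)%:R * (omega p k x / rho) ^+ k *
  \prod_(k.+1 <= j < K.+1) (omega (q j) k x / rho).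
Proof.
move=> /andP[k0 kK]; rewrite /outage_bound; case: eqP => [->|_].
  rewrite /omega [\sum_(1 <= m < 1) p m ^+ 2]big_geq// mulr0 subr0.
  rewrite bin1 expr1; congr (_ * _).
    by rewrite invfM [x * _]mulrC -!mulrA [rho^-1 * _]mulrC.
  apply: eq_bigr => j _; rewrite big_geq// mulr0 subr0 invfM.
  by rewrite mulrCA mulrC.
rewrite bin_sub// subKn// prod_natMr subSS div1r -mulrA.
by congr (_ * _); rewrite mulrC.
Qed.

(** The direct phase contributes [k] powers of [rho^-1] and the links the other [K - k], which is
    where full diversity comes from. *)
Lemma outage_bound_power (K : nat) (p : nat -> R) (q : nat -> nat -> R)
    (k : nat) (x rho : R) : (1 <= k <= K)%N ->
  outage_bound K p q k x rho =
  'C(K, k)%:R * omega p k x ^+ k *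
  (\prod_(k.+1 <= j < K.+1) omega (q j) k x) * rho^-1 ^+ K.
Proof.
move=> kK; rewrite outage_boundE//; case/andP: kK => k0 kK.
rewrite prod_natMr subSS exprMn.
rewrite (_ : rho^-1 ^+ K = rho^-1 ^+ k * rho^-1 ^+ (K - k)).
  by rewrite ['C(K, k)%:R * (_ * _)]mulrA mulrACA.
by rewrite -exprD subnKC.
Qed.

End Bound.

(** Writing the inverse as [x * expR (- ln (x ^+ 2))] reduces it to measurable functions; the factor
    [x] also gives the convention [0^-1 = 0]. *)
Lemma measurable_inv (R : realType) : measurable_fun setT (@GRing.inv R).
Proof.
rewrite (_ : @GRing.inv R = fun x => x * expR (- ln (x ^+ 2))).
  apply: measurable_funM => //; apply: (measurableT_comp (@measurable_expR R)).
  apply: measurable_funN.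
  by apply: (measurableT_comp (@measurable_ln R)); exact: measurable_funX.
apply/funext => x; have [->|x0] := eqVneq x 0; first by rewrite invr0 mul0r.
rewrite expRN lnK ?posrE ?exprn_even_gt0//.
by rewrite expr2 invfM mulrA divff// mul1r.
Qed.

(** * Measurability and pointwise consequences of a small SINR *)

Section Sinr.
Context d (T : measurableType d) (R : realType).

(** For user 1 only the noise [1 / rho] remains in each denominator, and dividing by it multiplies
    by [rho]. *)
Lemma sinrE (K : nat) (p : nat -> R) (q : nat -> nat -> R)
    (h : nat -> T -> R) (g : nat -> nat -> T -> R) (rho : R) (k : nat) (w : T) :
  0 < rho ->
  sinr K p q h g rho k w =
    (h k w * p k ^+ 2) / (h k w * (\sum_(1 <= m < k) p m ^+ 2) + 1 / rho) +
    \sum_(k.+1 <= j < K.+1)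
      (g j k w * q j k ^+ 2) /
      (g j k w * (\sum_(1 <= m < k) q j m ^+ 2) + 1 / rho).
Proof.
move=> rho0; rewrite /sinr; case: eqP => // ->.
rewrite [\sum_(1 <= m < 1) p m ^+ 2]big_geq// mulr0 add0r div1r invrK.
rewrite [_ * rho]mulrC -mulrA; congr (_ + _).
rewrite big_distrr/=; apply: eq_bigr => j _.
by rewrite big_geq// mulr0 add0r invrK mulrC.
Qed.

Lemma measurable_sinr (K : nat) (p : nat -> R) (q : nat -> nat -> R)
    (h : nat -> T -> R) (g : nat -> nat -> T -> R) (rho : R) (k : nat) :
  0 < rho -> measurable_fun setT (h k) ->
  (forall j, measurable_fun setT (g j k)) ->
  measurable_fun setT (sinr K p q h g rho k).
Proof.
move=> rho0 mh mg.
have mratio (u : T -> R) a b : measurable_fun setT u ->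
    measurable_fun setT (fun w => (u w * a) / (u w * b + 1 / rho)).
  move=> mu; apply: measurable_funM; first exact: measurable_funM.
  apply: (measurableT_comp (@measurable_inv R)); apply: measurable_funD => //.
  exact: measurable_funM.
rewrite (_ : sinr _ _ _ _ _ _ _ = fun w =>
  (h k w * p k ^+ 2) / (h k w * (\sum_(1 <= m < k) p m ^+ 2) + 1 / rho) +
    \sum_(k.+1 <= j < K.+1)
      (g j k w * q j k ^+ 2) /
      (g j k w * (\sum_(1 <= m < k) q j m ^+ 2) + 1 / rho)).
  by apply: measurable_funD; [exact: mratio|apply: measurable_sum => j; exact: mratio].
by apply/funext => w; exact: sinrE.
Qed.

Lemma sinr_le (K : nat) (p : nat -> R) (q : nat -> nat -> R)
    (h : nat -> T -> R) (g : nat -> nat -> T -> R) (rho x : R) (k : nat) (w : T) :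
  0 < rho -> nontrivial_branch K p q k x ->
  0 <= h k w -> (forall j, (k < j <= K)%N -> 0 <= g j k w) ->
  sinr K p q h g rho k w <= x ->
  h k w <= omega p k x / rho /\
  (forall j, (k < j <= K)%N -> g j k w <= omega (q j) k x / rho).
Proof.
move=> rho0 [xp xq] h0 g0; rewrite sinrE//.
have ratio_ge0 u a (s : seq nat) b : 0 <= u ->
    0 <= u * a ^+ 2 / (u * (\sum_(m <- s) b m ^+ 2) + 1 / rho).
  move=> u0; apply: divr_ge0; first by rewrite mulr_ge0 ?sqr_ge0.
  apply: addr_ge0; last by rewrite divr_ge0// ltW.
  by rewrite mulr_ge0// sumr_ge0// => m _; exact: sqr_ge0.
have gratio_ge0 j : (k < j <= K)%N -> 0 <= (g j k w * q j k ^+ 2) /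
      (g j k w * (\sum_(1 <= m < k) q j m ^+ 2) + 1 / rho).
  by move=> /g0; exact: ratio_ge0.
move=> sx; split => [|j jK].
  apply: le_omega => //; apply: le_trans sx; rewrite lerDl.
  by rewrite big_nat; apply: sumr_ge0 => j jK; exact: gratio_ge0.
apply: le_omega => //; [exact: g0|exact: xq|].
apply: le_trans sx; rewrite -[leLHS]add0r lerD//; first exact: ratio_ge0.
have jI : j \in index_iota k.+1 K.+1 by rewrite mem_index_iota ltnS.
rewrite [leRHS](bigD1_seq j)//= ?iota_uniq// lerDl big_seq_cond.
apply: sumr_ge0 => i; rewrite mem_index_iota ltnS => /andP[iK _].
exact: gratio_ge0.
Qed.

End Sinr.

(** * The outage probability and the diversity order *)

Section OutageBound.
Context d (T : measurableType d) (R : realType) (P : probability T R).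
Variables (K : nat) (H : nat -> {RV P >-> R}) (g : nat -> nat -> {RV P >-> R}).
Context (channel : rayleigh_channel K H g).

(** Exponential gains are nonnegative only almost surely, so this exceptional event is split off. It
    uses the unordered gains, whose laws are known directly. *)
Let negative_gains (k : nat) : set T :=
  \big[setU/set0]_(i <- iota 1 K) [set w | H i w < 0] `|`
  \big[setU/set0]_(k.+1 <= j < K.+1) [set w | g j k w < 0].

Let measurable_negative_gains k : measurable (negative_gains k).
Proof.
by apply: measurableU; apply: bigsetU_measurable => i _; exact: measurable_rv_lt.
Qed.

Let negative_gains_null k : (1 <= k)%N -> P (negative_gains k) = 0%E.
Proof.
move=> k0; apply/eqP; rewrite -measure_le0.
apply: (le_trans (measureU2 _ _ _)).
- by apply: bigsetU_measurable => i _; exact: measurable_rv_lt.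
- by apply: bigsetU_measurable => i _; exact: measurable_rv_lt.
rewrite -[leRHS]adde0; apply: leeD.
  apply: (le_trans (probability_bigsetU_le P _ _)).
    by move=> i; exact: measurable_rv_lt.
  rewrite big_seq big1// => i; rewrite mem_iota add1n ltnS => iK.
  exact/exponential_mean1_lt0/(direct_exp channel).
apply: (le_trans (probability_bigsetU_le P _ _)).
  by move=> i; exact: measurable_rv_lt.
rewrite big_seq big1// => j; rewrite mem_index_iota ltnS => /andP[kj jK].
apply: exponential_mean1_lt0; apply: (@coop_exp _ _ _ _ _ _ _ channel (j, k)).
by split=> //=; rewrite k0.
Qed.

Let order_statistic_ge0 k w : (forall i, i \in iota 1 K -> 0 <= H i w) ->
  0 <= order_statistic K H k w.
Proof.
move=> H0; rewrite /order_statistic; set s := sort _ _.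
(* Outside the list [nth] returns its default 0, which is nonnegative too. *)
have [ks|sk] := ltnP k.-1 (size s); last by rewrite nth_default.
have : nth 0 s k.-1 \in s by exact: mem_nth.
by rewrite mem_sort => /mapP[i iK ->]; exact: H0.
Qed.

Lemma outage_le_bound (p : nat -> R) (q : nat -> nat -> R) (k : nat) (x rho : R) :
  (1 <= k <= K)%N -> 0 < x -> nontrivial_branch K p q k x -> 0 < rho ->
  (outage K p q H g rho k x <= (outage_bound K p q k x rho)%:E)%E.
Proof.
move=> kK x0 branch rho0; have /andP[k0 _] := kK; have [xp xq] := branch.
set h := order_statistic K H.
pose A := [set w | h k w <= omega p k x / rho].
pose links := [seq (j, k) | j <- index_iota k.+1 K.+1].
pose t (jk : nat * nat) := omega (q jk.1) k x / rho.
pose B := \bigcap_(jk in [set` links]) [set w | g jk.1 jk.2 w <= t jk].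
have linksP jk : jk \in links -> user_links K jk /\ jk.2 = k.
  move=> /mapP[j]; rewrite mem_index_iota ltnS => /andP[kj jK] ->.
  by split=> //; split=> //=; rewrite k0.
have mh : measurable_fun setT (h k) by exact: measurable_order_statistic.
have mA : measurable A.
  rewrite (_ : A = h k @^-1` `]-oo, omega p k x / rho]).
    by rewrite -[X in measurable X]setTI; exact: mh.
  by apply/seteqP; split=> w /=; rewrite in_itv.
have mB : measurable B.
  by apply: fin_bigcap_measurable => // jk _; exact: measurable_rv_le.
have PA : (P A <= ('C(K, k)%:R * (omega p k x / rho) ^+ k)%:E)%E.
  apply: order_statistic_exponential_le => //.
  - exact: direct_indep channel.
  - exact: direct_exp channel.
  - by rewrite divr_gt0// omega_gt0.
have t_gt0 jk : jk \in links -> 0 < t jk.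
  move=> /mapP[j]; rewrite mem_index_iota ltnS => jK ->.
  by rewrite divr_gt0// omega_gt0//; exact: xq.
have PB : (P B <= (\prod_(k.+1 <= j < K.+1) (omega (q j) k x / rho))%:E)%E.
  apply: (le_trans (mutually_independent_exponential_le
    (coop_indep channel) (coop_exp channel) _ _ t_gt0)).
  - by rewrite map_inj_uniq ?iota_uniq// => i j [].
  - by move=> jk /linksP[].
  - by rewrite big_map.
have indepAB : P (B `&` A) = (P B * P A)%E.
  (* [B] is a finite intersection of generators of the sigma-algebra of the links, and [A] is a
     generator of that of the order statistics. *)
  apply: (coop_direct_indep channel).
    apply: (@fin_bigcap_measurable _ (g_sigma_algebraType _)) => //= jk /linksP[ujk _].
    apply: sub_sigma_algebra; exists jk => //.
    exists `]-oo, t jk]%classic; first exact: measurable_itv.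
    by rewrite setTI; apply/seteqP; split=> w /=; rewrite in_itv.
  apply: sub_sigma_algebra; exists k => //.
  exists `]-oo, omega p k x / rho]%classic; first exact: measurable_itv.
  by rewrite setTI; apply/seteqP; split=> w /=; rewrite in_itv.
(* Off the null event, outage forces both [A] and [B]; monotonicity of [P] also requires the outage
   event to be measurable. *)
apply: (@le_trans _ _ (P (negative_gains k `|` (B `&` A)))).
  apply: le_measure; rewrite ?inE.
  - rewrite (_ : [set w | _] = sinr K p q h g rho k @^-1` `]-oo, x]).
      rewrite -[X in measurable X]setTI; apply: measurable_sinr => // j.
    by apply/seteqP; split=> w /=; rewrite in_itv.
  - by apply: measurableU => //; exact: measurableI.
  - move=> w /= sx; have [|Nw] := pselect (negative_gains k w); first by left.
    right; have H0 i : i \in iota 1 K -> 0 <= H i w.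
      move=> iK; rewrite leNgt; apply/negP => Hi; apply: Nw; left.
      by rewrite -bigcup_seq; exists i.
    have g0 j : (k < j <= K)%N -> 0 <= g j k w.
      move=> jK; rewrite leNgt; apply/negP => gj; apply: Nw; right.
      by rewrite -bigcup_seq; exists j; rewrite //= mem_index_iota ltnS.
    have [Aw Bw] := sinr_le rho0 branch (order_statistic_ge0 k H0) g0 sx.
    split=> // jk /= /mapP[j]; rewrite mem_index_iota ltnS => jK ->.
    exact: Bw.
apply: (le_trans (measureU2 _ _ _)) => //; first exact: measurableI.
rewrite [X in (X + _)%E]negative_gains_null// add0e [leLHS]indepAB outage_boundE//.
by rewrite mulrC EFinM lee_pmul.
Qed.

End OutageBound.

Theorem mainTheorem2 (R : realType) (d : measure_display)
    (T : measurableType d) (P : probability T R)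
    (K : nat) (H : nat -> {RV P >-> R}) (g : nat -> nat -> {RV P >-> R})
    (p : nat -> R) (q : nat -> nat -> R)
    (channel : rayleigh_channel K H g)
    (p_ordered : forall k l, (1 <= k <= l)%N -> (l <= K)%N ->
       p k ^+ 2 <= p l ^+ 2)
    (p_sum : \sum_(1 <= m < K.+1) p m ^+ 2 = 1)
    (q_sum : \sum_(1 <= m < K) q K m ^+ 2 = 1) :
  forall k, (1 <= k <= K)%N ->
  forall x : R, 0 < x -> nontrivial_branch K p q k x ->
    (forall rho : R, 0 < rho ->
       (outage K p q H g rho k x <= (outage_bound K p q k x rho)%:E)%E) /\
    has_diversity_order (fun rho => outage_bound K p q k x rho) K%:R.
Proof.
move=> k kK x x0 branch; split=> [rho|]; first exact: outage_le_bound.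
have /andP[_ lekK] := kK; have [xp xq] := branch.
apply: (has_diversity_order_power _ (fun rho _ => outage_bound_power p q x rho kK)).
(* What remains is positivity of the constant in front of [rho^-1 ^+ K]: [k <= K] gives it for the
   binomial, the nontrivial branch for every [omega]. *)
rewrite !mulr_gt0 ?exprn_gt0 ?ltr0n ?bin_gt0 ?omega_gt0// big_seq.
apply: prodr_gt0 => j; rewrite mem_index_iota ltnS => jK.
by rewrite omega_gt0//; exact: xq.
Qed.
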